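(* Let $Y$ be a compact metrizable space. Assume that $Y$ admits a minimal continuous flow $\phi=(\varphi_t)_{t\in\mathbb R}$ whose centralizer $Z(\phi)$ in $\mathcal H(Y)$ acts transitively on $Y$ in the algebraic sense. Then for every minimal system $(X,T)$ and residually many $t\in\mathbb R$, the product $(X\times Y,T\times\varphi_t)$ is minimal. Consequently, $Y$ is homeo-product-minimal.
   Context: A dynamical system $(X,T)$ is a metrizable (not necessarily compact) space $X$ with a continuous map $T\colon X\to X$; it is minimal if there is no proper nonempty closed $M\subsetneq X$ with $T(M)\subseteq M$. A flow is minimal if every orbit $\{\varphi_t(y):t\in\mathbb R\}$ is dense. $\mathcal H(Y)$ is the group of homeomorphisms of $Y$ and $Z(\phi)=\{\psi\in\mathcal H(Y):\psi\circ\varphi_t=\varphi_t\circ\psi\text{ for every }t\in\mathbb R\}$. Transitivity in the algebraic sense means that for all $y,y'\in Y$ there is $\psi\in Z(\phi)$ with $\psi(y)=y'$. ''Residually many $t\in\mathbb R$'' means all $t$ in some residual subset of $\mathbb R$. A compact metrizable space $Y$ is homeo-product-minimal if for every minimal system $(X,T)$ with $X$ metrizable there is a homeomorphism $S\colon Y\to Y$ with $(X\times Y,T\times S)$ minimal. *)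

(* Defs.v *)
From HB Require Import structures.
From mathcomp Require Import all_boot all_order all_algebra.
From mathcomp Require Import all_classical all_reals all_analysis.

Set Implicit Arguments.
Unset Strict Implicit.
Unset Printing Implicit Defensive.

Import Order.TTheory GRing.Theory Num.Theory.
Import numFieldNormedType.Exports.
Local Open Scope classical_set_scope.
Local Open Scope ring_scope.

(* [topologicalType] carries neither separation nor nonemptiness; the metric
   must induce the given topology.  Nonnegativity of [d] follows from the
   other axioms. *)
Definition metrizable (R : realType) (X : topologicalType) : Prop :=
  exists d : X -> X -> R,
    [/\ forall x y, d x y = 0 <-> x = y,
        forall x y, d x y = d y x,
        forall x y z, d x z <= d x y + d y z
      & forall (x : X) (A : set X),
          nbhs x A <-> exists2 e : R, 0 < e & [set y | d x y < e] `<=` A].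

Definition dynamical_system (R : realType) (X : topologicalType)
    (T : X -> X) : Prop :=
  metrizable R X /\ continuous T.

Definition minimal_system (R : realType) (X : topologicalType)
    (T : X -> X) : Prop :=
  dynamical_system R T /\
  ~ exists M : set X,
      [/\ closed M, M !=set0, M `<` [set: X] & T @` M `<=` M].

Definition prod_map (X Y : Type) (T : X -> X) (S : Y -> Y) (p : X * Y) :
    X * Y :=
  (T p.1, S p.2).

Definition homeomorphism (X Y : topologicalType) (f : X -> Y) : Prop :=
  exists g : Y -> X, [/\ cancel f g, cancel g f, continuous f & continuous g].

(* Continuity is joint in time and space. *)
Definition continuous_flow (R : realType) (Y : topologicalType)
    (phi : R -> Y -> Y) : Prop :=
  [/\ phi 0 = id,
      forall s t, phi (s + t) = phi s \o phi t
    & continuous (fun p : R * Y => phi p.1 p.2)].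

Definition minimal_flow (R : realType) (Y : topologicalType)
    (phi : R -> Y -> Y) : Prop :=
  continuous_flow phi /\ forall y, dense [set phi t y | t in [set: R]].

Definition flow_centralizer (R : realType) (Y : topologicalType)
    (phi : R -> Y -> Y) : set (Y -> Y) :=
  [set psi | homeomorphism psi /\ forall t, psi \o phi t = phi t \o psi].

Definition acts_transitively (Y : Type) (Z : set (Y -> Y)) : Prop :=
  forall y y' : Y, exists2 psi, Z psi & psi y = y'.

Definition residual (X : topologicalType) (A : set X) : Prop :=
  exists U : nat -> set X,
    (forall n, open (U n) /\ dense (U n)) /\ \bigcap_n U n `<=` A.

(* Meaningful for compact metrizable [Y]. *)
Definition homeo_product_minimal (R : realType) (Y : topologicalType) : Prop :=
  forall (X : topologicalType) (T : X -> X), minimal_system R T ->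
    exists S : Y -> Y, homeomorphism S /\ minimal_system R (prod_map T S).

(* Main.v *)
Require Import Defs.
From mathcomp Require Import all_boot all_order all_algebra.
From mathcomp Require Import all_classical all_reals all_analysis.
From mathcomp Require Import lra.
Import Order.TTheory GRing.Theory Num.Theory.
Import numFieldNormedType.Exports.
Local Open Scope classical_set_scope.
Local Open Scope ring_scope.
Set Implicit Arguments.

(** Why the theorem holds.  Fix base points [x0] in [X] and [y0] in [Y], and let
    [U], [V] be nonempty open sets of [X] and [Y].  The times [t] at which the
    [T]x[phi t]-orbit of [(x0, y0)] visits [U]x[V] form an open set
    ([visit_times_open]), and this set is dense ([visit_times_dense]): the
    return times [n] of [x0] to [U] are unbounded, while the times [s] with
    [phi s y0] in [V] have gaps bounded by some [L].  For a return time [n] large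
    compared to [L / e], a number [n * t] can therefore be moved by less than
    [L], that is [t] by less than [e], so as to land in the second set.  Both
    spaces contain a countable dense piece of an orbit, hence have countable
    bases, and intersecting over pairs of basic sets yields residually many [t]
    for which the orbit of this single point [(x0, y0)] is dense.

    One dense orbit is enough ([transitive_centralizer_minimal_product]).  A
    nonempty closed invariant set [M] projects onto a closed invariant subset of
    [X], because [Y] is compact; this subset is all of [X], so [M] contains some
    [(x0, y)].  A homeomorphism [psi] in the centralizer with [psi y = y0] makes
    [id]x[psi] commute with [T]x[phi t], so the orbit of [(x0, y)] is as dense as
    that of [(x0, y0)], and [M] is everything.

    Residual subsets of the line are nonempty by Baire's theorem, which gives
    the homeomorphism required for homeo-product-minimality. *)

(** * Residual sets, countable bases and products of metrizable spaces *)

Lemma residual_bigcap_countable (X : topologicalType) (I : Type) (D : set I)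
    (F : I -> set X) :
  countable D -> (forall i, D i -> open (F i) /\ dense (F i)) ->
  residual (\bigcap_(i in D) F i).
Proof.
move=> /countable_injP[f f_inj] F_od.
(* The fibre of the injection [f] over [n] has at most one point: the [n]-th set
   is one of the [F i], or the whole space when the fibre is empty. *)
exists (fun n => \bigcap_(i in [set i | D i /\ f i = n]) F i); split=> [n|]; last first.
  by move=> x Ux i Di; apply: (Ux (f i)).
have [[i [Di fi]]|none] := pselect (exists i, D i /\ f i = n).
  suff -> : [set j | D j /\ f j = n] = [set i] by rewrite bigcap_set1; exact: F_od.
  apply/seteqP; split=> [j [Dj fj]|_ ->//].
  by apply: f_inj; rewrite ?inE // fi fj.
have -> : [set j | D j /\ f j = n] = set0.
  by apply/seteqP; split=> // j Dj; apply: none; exists j.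
by rewrite bigcap_set0; split; [exact: openT|move=> O [x Ox] _; exists x].
Qed.

Lemma residualT (X : topologicalType) : residual [set: X].
Proof.
exists (fun=> setT); split=> // _.
by split; [exact: openT|move=> O [x Ox] _; exists x].
Qed.

(** The balls of radius [1 / (k + 1)] around the points of a countable dense
    family form a basis. *)
Lemma metrizable_second_countable (R : realType) (X : topologicalType)
    (I : countType) (u : I -> X) :
  metrizable R X -> dense (range u) -> @second_countable X.
Proof.
move=> [d [d0 dC d_tri d_nbhs]] u_dense.
pose ball (p : I * nat) := [set x | d (u p.1) x < p.2.+1%:R^-1].
have ball_open p : open (ball p).
  rewrite openE => x /= dx; apply/d_nbhs.
  exists (p.2.+1%:R^-1 - d (u p.1) x); first by rewrite subr_gt0.
  move=> y /= dxy; rewrite /ball /=; apply: le_lt_trans (d_tri _ x _) _.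
  by rewrite -ltrBrDl.
exists (range ball).
  exact: card_le_trans (card_image_le _ _) (countableP _).
split=> [_ [p _ <-]//|x N /d_nbhs[e e0 eN]].
have e20 : 0 < e / 2 by rewrite divr_gt0.
have [k k_lt] : exists k : nat, k.+1%:R^-1 < e / 2.
  have [k _ /(_ _ (leqnn k)) kP] := near_infty_natSinv_lt (PosNum e20).
  by exists k.
have : nbhs x [set y | d x y < k.+1%:R^-1].
  by apply/d_nbhs; exists (k.+1%:R^-1); rewrite ?invr_gt0.
rewrite nbhsE => -[W [W_open Wx] W_ball].
have [z [/W_ball xi [i _ ui]]] : W `&` range u !=set0.
  by apply: u_dense => //; exists x.
subst.
exists (ball (i, k)).
  by split; [exists (i, k)|rewrite /ball /= dC].
move=> y /= iy; apply: eN => /=; apply: le_lt_trans (d_tri _ (u i) _) _.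
by rewrite [e]splitr ltrD ?(lt_trans _ k_lt).
Qed.

Lemma metrizable_prod (R : realType) (X Y : topologicalType) :
  metrizable R X -> metrizable R Y -> metrizable R (X * Y)%type.
Proof.
move=> [d [d0 dC d_tri d_nbhs]] [e [e0 eC e_tri e_nbhs]].
(* Nonnegativity is what makes a vanishing maximum force both distances to vanish. *)
have d_ge0 x x' : 0 <= d x x'.
  by have := d_tri x x' x; rewrite (d0 x x).2 // (dC x' x); lra.
have e_ge0 y y' : 0 <= e y y'.
  by have := e_tri y y' y; rewrite (e0 y y).2 // (eC y' y); lra.
exists (fun p q => Num.max (d p.1 q.1) (e p.2 q.2)); split.
- move=> [x y] [x' y'] /=; split=> [max0|[-> ->]].
    have : Num.max (d x x') (e y y') <= 0 by rewrite max0.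
    rewrite ge_max => /andP[dx ey].
    congr (_, _); [apply/d0|apply/e0]; apply/le_anti.
      by rewrite dx d_ge0.
    by rewrite ey e_ge0.
  by rewrite (d0 _ _).2 // (e0 _ _).2 // maxxx.
- by move=> p q; rewrite dC eC.
- move=> p q r; rewrite ge_max; apply/andP; split.
    by apply: le_trans (d_tri _ q.1 _) _; rewrite lerD // le_max lexx.
  by apply: le_trans (e_tri _ q.2 _) _; rewrite lerD // le_max lexx orbT.
move=> [x y] A; split.
  move=> [[U V] /= [/d_nbhs[r r0 rU] /e_nbhs[s s0 sV]] UVA].
  exists (Num.min r s); first by rewrite lt_min r0.
  move=> [x' y'] /=; rewrite gt_max !lt_min => /andP[/andP[dr _] /andP[_ es]].
  by apply: UVA; split; [exact: rU|exact: sV].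
move=> [r r0 rA].
exists ([set x' | d x x' < r], [set y' | e y y' < r]) => /=.
  by split; [apply/d_nbhs|apply/e_nbhs]; exists r.
by move=> [x' y'] /= [dr er]; apply: rA; rewrite /= gt_max dr.
Qed.

Lemma prod_map_continuous (X Y : topologicalType) (T : X -> X) (S : Y -> Y) :
  continuous T -> continuous S -> continuous (prod_map T S).
Proof.
move=> T_cont S_cont [x y].
apply: (@cvg_pair _ _ _ _ _ _ _ _ _ (T \o fst) (S \o snd)).
  by apply: continuous_comp; [exact: cvg_fst|exact: T_cont].
by apply: continuous_comp; [exact: cvg_snd|exact: S_cont].
Qed.

Lemma prod_map_dynamical_system (R : realType) (X Y : topologicalType)
    (T : X -> X) (S : Y -> Y) :
  dynamical_system R T -> metrizable R Y -> continuous S ->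
  dynamical_system R (prod_map T S).
Proof.
move=> [X_metr T_cont] Y_metr S_cont; split; first exact: metrizable_prod.
exact: prod_map_continuous.
Qed.

(** Closedness of the projection is where the compactness of [Y] enters the
    minimality argument: if the fibre of [M] over [x] is empty, finitely many
    boxes missing [M] cover [{x}]x[Y], hence a whole tube around it. *)
Lemma closed_fst_image (X Y : topologicalType) (M : set (X * Y)) :
  compact [set: Y] -> closed M -> closed (fst @` M).
Proof.
move=> /compact_near_coveringP Y_cover M_closed; rewrite -openC openE => x Mx.
have : \forall x' \near x, [set: Y] `<=` (fun y => ~ M (x', y)).
  apply: Y_cover => y _.
  have : nbhs (x, y) (~` M).
    apply: open_nbhs_nbhs; split; first exact: closed_openC.
    by move=> /= Mxy; apply: Mx; exists (x, y).
  move=> [[U V] /= [Ux Vy] UVM]; exists (V, U) => //= -[y' x'] /= [Vy' Ux'].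
  exact: (UVM (x', y')).
by apply: filterS => x' M'x' [[z y] /= Mzy zx']; apply: (M'x' y); rewrite // -zx'.
Qed.

(** * Flows *)

Lemma iter_prod_map_flow (R : realType) (X : Type) (Y : topologicalType)
    (T : X -> X) (phi : R -> Y -> Y) (t : R) (n : nat) (x : X) (y : Y) :
  continuous_flow phi ->
  iter n (prod_map T (phi t)) (x, y) = (iter n T x, phi (n%:R * t) y).
Proof.
move=> [phi0 phiD _]; elim: n => [|n IHn]; first by rewrite mul0r phi0.
by rewrite !iterS IHn /prod_map /= -natr1 mulrDl mul1r addrC phiD.
Qed.

Lemma flow_orbit_continuous (R : realType) (Y : topologicalType)
    (phi : R -> Y -> Y) (y : Y) :
  continuous_flow phi -> continuous (phi^~ y).
Proof.
move=> [_ _ phi_cont] t.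
apply: (@continuous_comp _ _ _ (fun s => (s, y)) (fun p => phi p.1 p.2)).
  exact: (cvg_pair (@cvg_id _ _) (cvg_cst _)).
exact: phi_cont.
Qed.

Lemma flow_time_continuous (R : realType) (Y : topologicalType)
    (phi : R -> Y -> Y) (t : R) :
  continuous_flow phi -> continuous (phi t).
Proof.
move=> [_ _ phi_cont] y.
apply: (@continuous_comp _ _ _ (fun z => (t, z)) (fun p => phi p.1 p.2)).
  exact: (cvg_pair (cvg_cst _) (@cvg_id _ _)).
exact: phi_cont.
Qed.

Lemma flow_homeomorphism (R : realType) (Y : topologicalType)
    (phi : R -> Y -> Y) (t : R) :
  continuous_flow phi -> homeomorphism (phi t).
Proof.
move=> phi_flow; have [phi0 phiD _] := phi_flow.
exists (phi (- t)); split; try exact: flow_time_continuous.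
  by move=> y; rewrite -[phi (- t) _]/((phi (- t) \o phi t) y) -phiD addNr phi0.
by move=> y; rewrite -[phi t _]/((phi t \o phi (- t)) y) -phiD addrN phi0.
Qed.

(** * Return times *)

(** Return times are unbounded because the closure of every tail
    [T^N x, T^(N+1) x, ...] is itself closed and invariant, hence everything. *)
Lemma minimal_system_recurrence (R : realType) (X : topologicalType)
    (T : X -> X) (x : X) (N : nat) (U : set X) :
  minimal_system R T -> open U -> U !=set0 ->
  exists2 n, (N <= n)%N & U (iter n T x).
Proof.
move=> [[_ T_cont] T_min] U_open [z Uz]; apply: contrapT => avoid.
pose tail := [set iter n T x | n in [set n | (N <= n)%N]].
apply: T_min; exists (closure tail); split.
- exact: closed_closure.
- by exists (iter N T x); apply: subset_closure; exists N => /=.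
- split=> // /(_ z Logic.I) tailz.
  have [_ [[n Nn <-] Un]] := tailz U (open_nbhs_nbhs (conj U_open Uz)).
  by apply: avoid; exists n.
move=> _ [p tailp <-] W /T_cont TW.
have [_ [[n Nn <-] Wn]] := tailp _ TW.
by exists (T (iter n T x)); split=> //; exists n.+1; rewrite //= leqW.
Qed.

(** Every point of [Y] reaches [V] at some time, and so do its neighbours at the
    same time; by compactness finitely many times suffice, whence a bound [L]
    uniform in [y].  Applied to the point [phi a y], it bounds the distance from
    [a] to a visit of [y]. *)
Lemma minimal_flow_bounded_gaps (R : realType) (Y : topologicalType)
    (phi : R -> Y -> Y) (V : set Y) :
  compact [set: Y] -> minimal_flow phi -> open V -> V !=set0 ->
  exists L : R, forall y a, exists2 s, `|s - a| < L & V (phi s y).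
Proof.
move=> Y_compact [phi_flow phi_dense] V_open V0.
have : \forall L \near +oo,
    [set: Y] `<=` (fun y => exists2 s, `|s| < L & V (phi s y)).
  move/compact_near_coveringP: Y_compact; apply=> y _.
  have [z [Vs [s _ sy]]] := phi_dense y V V0 V_open; subst.
  exists ([set z | V (phi s z)], [set L | `|s| < L]) => /=.
    split; last exact: nbhs_pinfty_gt.
    by apply: (flow_time_continuous s phi_flow); exact: open_nbhs_nbhs.
  by move=> [z L] /= [Vz sL]; exists s.
case/filter_ex => L L_gap; exists L => y a.
have [s sL Vs] := L_gap (phi a y) Logic.I.
exists (s + a); first by rewrite addrK.
by have [_ -> _] := phi_flow.
Qed.

Lemma visit_times_open (R : realType) (X Y : topologicalType) (T : X -> X)
    (phi : R -> Y -> Y) (x : X) (y : Y) (U : set X) (V : set Y) :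
  continuous_flow phi -> open V ->
  open [set t : R | exists2 n, U (iter n T x) & V (phi (n%:R * t) y)].
Proof.
move=> phi_flow V_open.
rewrite openE => t /= [n Un Vt].
have : nbhs t [set s | V (phi (n%:R * s) y)].
  apply: (@continuous_comp _ _ _ (fun s : R => n%:R * s) (phi^~ y)).
  - exact: mulrl_continuous.
  - exact: flow_orbit_continuous.
  - exact: open_nbhs_nbhs.
by apply: filterS => s Vs; exists n.
Qed.

(** A return time [n] with [n * e > L] turns the error [L] on [n * t] allowed by
    the bounded gaps into an error smaller than [e] on [t]. *)
Lemma visit_times_dense (R : realType) (X Y : topologicalType) (T : X -> X)
    (phi : R -> Y -> Y) (x : X) (y : Y) (U : set X) (V : set Y) :
  compact [set: Y] -> minimal_system R T -> minimal_flow phi ->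
  open U -> U !=set0 -> open V -> V !=set0 ->
  dense [set t : R | exists2 n, U (iter n T x) & V (phi (n%:R * t) y)].
Proof.
move=> Y_compact T_min phi_min U_open U0 V_open V0 O [t Ot] O_open.
have [L L_gap] := minimal_flow_bounded_gaps Y_compact phi_min V_open V0.
have /nbhs_ballP[e /= e0 eO] : nbhs t O by exact: open_nbhs_nbhs.
have [n n_large Un] :=
  minimal_system_recurrence x (Num.truncn (`|L| / e)).+1 T_min U_open U0.
have n0 : 0 < n%:R :> R by rewrite ltr0n (leq_trans _ n_large).
have L_lt : L < n%:R * e.
  apply: le_lt_trans (ler_norm L) _.
  rewrite -ltr_pdivrMr //; apply: lt_le_trans (truncnS_gt _) _.
  by rewrite ler_nat.
have [s s_near Vs] := L_gap y (n%:R * t).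
exists (s / n%:R); split; last by exists n; rewrite // mulrC divfK // gt_eqF.
apply: eO; rewrite /ball /= distrC.
rewrite -(ltr_pM2l n0) -[X in X * _](gtr0_norm n0) -normrM mulrBr.
by rewrite [_ * (s / _)]mulrC divfK ?gt_eqF // (lt_trans s_near).
Qed.

(** * Minimality of the product *)

(** The centralizer transports the density of the orbit of [(x0, y0)] to all
    points [(x0, y)], and every nonempty closed invariant set contains one of
    them. *)
Lemma transitive_centralizer_minimal_product (R : realType)
    (X Y : topologicalType) (T : X -> X) (phi : R -> Y -> Y) (t : R)
    (x0 : X) (y0 : Y) :
  compact [set: Y] -> metrizable R Y -> minimal_system R T ->
  continuous_flow phi -> acts_transitively (flow_centralizer phi) ->
  (forall U V, open U -> U !=set0 -> open V -> V !=set0 ->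
     exists2 n, U (iter n T x0) & V (phi (n%:R * t) y0)) ->
  minimal_system R (prod_map T (phi t)).
Proof.
move=> Y_compact Y_metr [T_sys T_min] phi_flow Z_trans xy0_dense.
split.
  by apply: prod_map_dynamical_system => //; exact: flow_time_continuous.
move=> [M [M_closed M0 M_proper M_inv]]; apply: T_min.
have [p Mp] := M0.
exists (fst @` M); split.
- exact: closed_fst_image.
- by exists p.1, p.
- split=> // fstM.
  have [[x y] Mxy xx0] := fstM x0 Logic.I.
  rewrite /= in xx0; subst.
  have [psi [[g [psiK gK psi_cont g_cont]] psiC] psiy] := Z_trans y y0.
  have M_iter n : M (iter n T x0, phi (n%:R * t) y).
    rewrite -iter_prod_map_flow //; elim: n => //= n Mn.
    by apply: M_inv; exists (iter n (prod_map T (phi t)) (x0, y)).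
  case: M_proper => _; apply=> -[x z] _.
  apply: M_closed => W [[U V] /= []].
  rewrite !nbhsE => -[U' [U'_open U'x] U'U] [V' [V'_open V'z] V'V] UVW.
  have gV_open : open (g @^-1` V') by move/continuousP: g_cont; exact.
  (* [psi] maps the orbit of [(x0, y)] to that of [(x0, y0)], so a visit of the
     latter to [psi V'] is a visit of the former to [V']. *)
  have [||n Un Vn] := xy0_dense U' (g @^-1` V') U'_open _ gV_open.
  - by exists x.
  - by exists (psi z); rewrite /= psiK.
  - exists (iter n T x0, phi (n%:R * t) y); split=> //.
    apply: UVW; split=> /=; first exact: U'U.
    have psi_phi : psi (phi (n%:R * t) y) = phi (n%:R * t) y0.
      by rewrite -psiy; exact: (congr1 (fun f => f y) (psiC (n%:R * t))).
    by apply: V'V; rewrite -[phi _ y]psiK psi_phi.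
- move=> _ [_ [q Mq <-] <-]; exists (prod_map T (phi t) q) => //.
  by apply: M_inv; exists q.
Qed.

Theorem theorem44 (R : realType) (Y : topologicalType)
    (Ycompact : compact [set: Y]) (Ymetrizable : metrizable R Y)
    (phi : R -> Y -> Y) (phi_minimal : minimal_flow phi)
    (Z_transitive : acts_transitively (flow_centralizer phi)) :
  (forall (X : topologicalType) (T : X -> X), minimal_system R T ->
     exists2 A : set R, residual A &
       forall t : R, A t -> minimal_system R (prod_map T (phi t)))
  /\ homeo_product_minimal R Y.
Proof.
have [phi_flow phi_dense] := phi_minimal.
suff residually (X : topologicalType) (T : X -> X) : minimal_system R T ->
    exists2 A : set R, residual A &
      forall t : R, A t -> minimal_system R (prod_map T (phi t)).
  split=> // X T /residually[A [U [U_od UA]] A_min].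
  have [t [_ Ut]] : [set: R] `&` \bigcap_n U n !=set0.
    by apply: (@Baire R R U U_od); [exists 0|exact: openT].
  by exists (phi t); split; [exact: flow_homeomorphism|exact/A_min/UA].
move=> T_min.
(* An empty product has no nonempty subset, so every [t] qualifies. *)
have [[[x0 y0] _]|empty] := pselect ([set: X * Y] !=set0); last first.
  exists [set: R]; first exact: residualT.
  move=> t _; have [T_sys _] := T_min; split.
    by apply: prod_map_dynamical_system => //; exact: flow_time_continuous.
  by move=> [M [_ [p Mp] _ _]]; apply: empty; exists p.
have [BX BX_count [BX_open BX_basis]] : @second_countable X.
  apply: (@metrizable_second_countable R X _ (fun n : nat => iter n T x0)).
    by case: T_min => -[].
  move=> O O0 O_open.
  have [n _ On] := minimal_system_recurrence x0 0 T_min O_open O0.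
  by exists (iter n T x0); split=> //; exists n.
have [BY BY_count [BY_open BY_basis]] : @second_countable Y.
  apply: (@metrizable_second_countable R Y _ (fun q : rat => phi (ratr q) y0)).
    by [].
  move=> O O0 O_open.
  have [z [Os [s _ sy]]] := phi_dense y0 O O0 O_open; subst.
  have [r [Or [q _ qr]]] : [set r | O (phi r y0)] `&` range ratr !=set0.
    apply: dense_rat; first by exists s.
    exact: (continuousP _).1 (flow_orbit_continuous y0 phi_flow) _ O_open.
  by exists (phi r y0); split=> //; exists q; rewrite // qr.
pose D := [set W : set X * set Y |
  [/\ BX W.1, BY W.2, W.1 !=set0 & W.2 !=set0]].
pose visits (W : set X * set Y) :=
  [set t : R | exists2 n, W.1 (iter n T x0) & W.2 (phi (n%:R * t) y0)].
exists (\bigcap_(W in D) visits W).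
  apply: residual_bigcap_countable.
    apply: sub_countable (countableX BX_count BY_count).
    by apply: subset_card_le => W [].
  move=> [U V] [/= BU BV U0 V0]; split.
    exact: visit_times_open phi_flow (BY_open _ BV).
  by apply: visit_times_dense => //; [exact: BX_open|exact: BY_open].
move=> t t_visits; apply: (transitive_centralizer_minimal_product t x0 y0) => //.
move=> U V U_open [x Ux] V_open [y Vy].
have [U' [BU' U'x] U'U] := BX_basis x U (open_nbhs_nbhs (conj U_open Ux)).
have [V' [BV' V'y] V'V] := BY_basis y V (open_nbhs_nbhs (conj V_open Vy)).
have [|n U'n V'n] := t_visits (U', V').
  by split=> //=; [exists x|exists y].
by exists n; [exact: U'U|exact: V'V].
Qed.
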